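(* Let $d\ge1$ and let $\Gamma$ be an irreducible component of the incidence scheme $\{(c,[f])\in M_d\times S: c^*(f)=0\}$ that dominates $S$ (it is assumed that such a $\Gamma$ exists). Let $\mathbb L$ be a (small) open subset, centered around $[f_0]$, of a generic plane in $S$ spanned by quintics $[f_0],[f_1],[f_2]$, let $\Gamma_{\mathbb L}$ be an irreducible component of $\Gamma\cap(M\times\mathbb L)$ that is onto $\mathbb L$, and let $P:\Gamma_{\mathbb L}\to M$ be the projection. Let $\mathbf t=(t_1,\dots,t_{5d+1})$ be a generic tuple of $5d+1$ distinct points of $\mathbb C\subset\mathbf P^1$. If the form $\omega(\mathbb L,\mathbf t)$ is non-zero on $P(\Gamma_{\mathbb L})$ (i.e. not identically zero on $P(\Gamma_{\mathbb L})$), then the Zariski tangent space of the scheme $P(\Gamma_{\mathbb L})$ at a generic closed point has dimension $$\dim(M)-\deg(\omega(\mathbb L,\mathbf t)),$$ where $\deg(\omega(\mathbb L,\mathbf t))=5d-1$ is the degree of $\omega(\mathbb L,\mathbf t)$ as a differential form.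
   Context: We work over $\mathbb C$. $S=\mathbf P(H^0(\mathcal O_{\mathbf P^4}(5)))$ is the space of quintics, and $[f]\in S$ is the class of a non-zero quintic form $f$. $M=(H^0(\mathcal O_{\mathbf P^1}(d)))^{\oplus5}\simeq\mathbb C^{5d+5}$; $M_d\subset M$ is the subset of those $c$ which define maps $\mathbf P^1\to\mathbf P^4$ that are birational onto their images and whose push-forward cycles have degree $d$. Using an affine coordinate $t$ on $\mathbb C\subset\mathbf P^1$, sections of $\mathcal O_{\mathbf P^1}(d)$ are regarded as polynomials in $t$ of degree $\le d$, so for $c\in M$ and a quintic form $f$, $f(c(t))$ is a polynomial in $t$ of degree $\le 5d$; $c^*(f)=0$ means that it vanishes identically. For $i=3,\dots,5d+1$ put $$D_i(c)=\left|\begin{array}{ccc} f_2(c(t_i)) & f_1(c(t_i)) & f_0(c(t_i))\\ f_2(c(t_1)) & f_1(c(t_1)) & f_0(c(t_1))\\ f_2(c(t_2)) & f_1(c(t_2)) & f_0(c(t_2))\end{array}\right|,\qquad \phi_i=dD_i,$$ $$\omega(\mathbb L,\mathbf t)=\phi_3\wedge\phi_4\wedge\cdots\wedge\phi_{5d+1}\in H^0(\Omega_M^{5d-1}).$$ $P(\Gamma_{\mathbb L})$ is regarded as the quasi-affine subscheme of $M$ whose defining polynomials (at a generic point) are $D_3,\dots,D_{5d+1}$. *)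

(* Defs.v *)
From mathcomp Require Import all_boot all_order all_algebra.
From mathcomp Require Export reals complex.
From mathcomp Require Export mpoly.

Set Implicit Arguments.
Unset Strict Implicit.
Unset Printing Implicit Defensive.

Import GRing.Theory.
Local Open Scope ring_scope.

Section PolynomialFunctions.
Variables (F : fieldType) (V : vectType F).

Definition coords (v : V) (k : 'I_(\dim {:V})) : F := coord (vbasis {:V}) k v.

Definition linear_poly (l : V -> F) : {mpoly F[\dim {:V}]} :=
  \sum_(k < \dim {:V}) l (vbasis {:V})`_k *: 'X_k.

Definition evalp (p : {mpoly F[\dim {:V}]}) (x : V) : F := p.@[coords x].

(* The value at the point x of the 1-form dp, on the tangent vector v. *)
Definition differential (p : {mpoly F[\dim {:V}]}) (x v : V) : F :=
  \sum_k (p^`M(k)).@[coords x] * coords v k.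

(* A differential k-form on V, as a function of a point and k tangent vectors
   (only alternating multilinear ones are built, by wedge below). *)
Definition dform (k : nat) := V -> ('I_k -> V) -> F.

Definition form_degree (k : nat) (w : dform k) : nat := k.

Definition wedge (k : nat) (phi : 'I_k -> V -> V -> F) : dform k :=
  fun x v => \det (\matrix_(a < k, b < k) phi a x (v b)).

Definition nonzero_at (k : nat) (w : dform k) (x : V) : Prop :=
  exists v, w x v <> 0.

Definition is_ideal (I : {mpoly F[\dim {:V}]} -> Prop) : Prop :=
  [/\ I 0, forall p q, I p -> I q -> I (p + q) & forall a p, I p -> I (a * p)].

Definition generated_by (n : nat) (D : 'I_n -> {mpoly F[\dim {:V}]})
    (p : {mpoly F[\dim {:V}]}) : Prop :=
  exists a : 'I_n -> {mpoly F[\dim {:V}]}, p = \sum_j a j * D j.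

(* On some basic open set h <> 0 that meets Y, the scheme with ideal I is the
   scheme D = 0: the localizations at h of the two ideals agree. *)
Definition defined_at_generic_point (n : nat) (Y : V -> Prop)
    (I : {mpoly F[\dim {:V}]} -> Prop) (D : 'I_n -> {mpoly F[\dim {:V}]}) : Prop :=
  exists2 h, exists2 x, Y x & evalp h x <> 0 &
    forall p, (exists k, I (h ^+ k * p)) <-> (exists k, generated_by D (h ^+ k * p)).

(* The Zariski tangent space at x of the subscheme of V with ideal I. *)
Definition in_tangent_space (I : {mpoly F[\dim {:V}]} -> Prop) (x v : V) : Prop :=
  forall p, I p -> differential p x v = 0.

Definition tangent_space_dim (I : {mpoly F[\dim {:V}]} -> Prop) (x : V) (n : nat) :=
  exists2 T : {vspace V}, forall v, v \in T <-> in_tangent_space I x v & \dim T = n.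

End PolynomialFunctions.

(* P(W) is the set of lines of W; [f] is the line <[f]>. *)
Definition proj (F : fieldType) (W : vectType F) := {l : {vspace W} | \dim l == 1%N}.

Section Zariski.
Variable F : fieldType.

(* Each point x of T is sent to a cone in V: a point for affine space, a line
   for projective space.  Closed sets are given by polynomial equations that hold
   on the whole cone; a polynomial vanishes on a line iff all its homogeneous
   components do, so these are the usual homogeneous equations. *)
Definition zclosed_for (T : Type) (V : vectType F) (cone : T -> V -> Prop)
    (A : T -> Prop) : Prop :=
  exists I : {mpoly F[\dim {:V}]} -> Prop,
    forall x, A x <-> forall p v, I p -> cone x v -> evalp p v = 0.

Definition zclosed (V : vectType F) : (V -> Prop) -> Prop :=
  zclosed_for (fun x v : V => v = x).

Definition zclosed_proj (W : vectType F) : (proj W -> Prop) -> Prop :=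
  zclosed_for (fun (s : proj W) (f : W) => f \in val s).

Definition zclosed_prod (V W : vectType F) : (V * proj W -> Prop) -> Prop :=
  zclosed_for (fun (x : V * proj W) (y : V * W) => y.1 = x.1 /\ y.2 \in val x.2).

Section Topology.
Variables (T : Type) (closed : (T -> Prop) -> Prop).

Definition irreducible (Y : T -> Prop) : Prop :=
  (exists x, Y x) /\
  forall A B, closed A -> closed B -> (forall x, Y x -> A x \/ B x) ->
    (forall x, Y x -> A x) \/ (forall x, Y x -> B x).

Definition irreducible_component (X Y : T -> Prop) : Prop :=
  [/\ forall x, Y x -> X x, irreducible Y &
      forall Z, irreducible Z -> (forall x, Z x -> X x) ->
        (forall x, Y x -> Z x) -> forall x, Z x -> Y x].

Definition open_in (X L : T -> Prop) : Prop :=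
  exists2 A, closed A & forall x, L x <-> X x /\ ~ A x.

(* P holds on a non-empty open subset of Y; every use is for an irreducible Y,
   in which non-empty open subsets are dense. *)
Definition generic_on (Y P : T -> Prop) : Prop :=
  exists2 A, closed A & (exists2 x, Y x & ~ A x) /\ forall x, Y x -> ~ A x -> P x.

End Topology.

Definition generic (V : vectType F) (P : V -> Prop) : Prop :=
  generic_on (@zclosed V) (fun=> True) P.

End Zariski.

Section RationalCurves.
Variables (F : fieldType) (d : nat).

(* Row k of c lists the coefficients, from degree 0 to d, of the k-th section
   of O(d) as a polynomial in t. *)
Definition Mspace : vectType F := 'M[F]_(5, d.+1).
Definition quintic : vectType F := dhomog 5 F 5.
Definition P4 := proj 'rV[F]_5.

Definition section (c : Mspace) (k : 'I_5) : {poly F} := rVpoly (row k c).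

(* c^*(g) = g(c(t)). *)
Definition pullback (c : Mspace) (g : {mpoly F[5]}) : {poly F} :=
  mmap (@polyC F) (section c) g.

(* (g0 : g1) is a rational inverse to c, from the image of c to P^1. *)
Definition birational_onto_image (c : Mspace) : Prop :=
  exists k (g0 g1 : {mpoly F[5]}),
    [/\ g0 \is k.-homog, g1 \is k.-homog, pullback c g1 <> 0
      & pullback c g0 = 'X * pullback c g1].

(* The closure of c(P^1), which is c(P^1) when c is extended across its base
   points. *)
Definition image_curve (c : Mspace) (s : P4) : Prop :=
  forall k (g : {mpoly F[5]}), g \is k.-homog -> pullback c g = 0 ->
    forall p, p \in val s -> g.@[fun i => p 0 i] = 0.

Definition hyperplane (a : 'rV[F]_5) (s : P4) : Prop :=
  forall p, p \in val s -> \sum_i a 0 i * p 0 i = 0.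

Definition has_card (T : eqType) (A : T -> Prop) (n : nat) : Prop :=
  exists2 l : seq T, uniq l && (size l == n) & forall x, x \in l <-> A x.

(* The number of points of a generic hyperplane section. *)
Definition curve_degree (Y : P4 -> Prop) (n : nat) : Prop :=
  generic (fun a : 'rV[F]_5 => has_card (fun s => Y s /\ hyperplane a s) n).

(* The push-forward cycle c_*[P^1] is deg(P^1 / image) [image], that is [image]
   for c birational onto its image; base points of c lower its degree below d. *)
Definition Md (c : Mspace) : Prop :=
  birational_onto_image c /\ curve_degree (image_curve c) d.

Definition incidence (x : Mspace * proj quintic) : Prop :=
  Md x.1 /\ forall f : quintic, f \in val x.2 -> pullback x.1 f = 0.

Definition dominates (G : Mspace * proj quintic -> Prop) : Prop :=
  forall A, zclosed_proj A -> (forall x, G x -> A x.2) -> forall s, A s.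

Definition plane (f0 f1 f2 : quintic) (s : proj quintic) : Prop :=
  (val s <= <<[:: f0; f1; f2]>>)%VS.

Definition restrict_to (G : Mspace * proj quintic -> Prop) (L : proj quintic -> Prop)
  (x : Mspace * proj quintic) : Prop := G x /\ L x.2.

Definition onto (GL : Mspace * proj quintic -> Prop) (L : proj quintic -> Prop) :=
  forall s, L s <-> exists c, GL (c, s).

Definition projM (GL : Mspace * proj quintic -> Prop) (c : Mspace) : Prop :=
  exists s, GL (c, s).

(* The polynomial function c |-> f(c(s)) on M. *)
Definition value_poly (f : quintic) (s : F) : {mpoly F[\dim {:Mspace}]} :=
  f \mPo [tuple linear_poly (fun c : Mspace => (section c k).[s]) | k < 5].

Section Omega.
Variables (f0 f1 f2 : quintic) (t : 'rV[F]_(5 * d).+1).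

(* t_i, numbered from 1 to 5d+1. *)
Definition tpt (i : nat) : F := t 0 (inord i.-1).

Definition Dpoly (i : nat) : {mpoly F[\dim {:Mspace}]} :=
  \det (\matrix_(r < 3, q < 3)
    value_poly (nth 0 [:: f2; f1; f0] q) (tpt (nth 0%N [:: i; 1; 2]%N r))).

(* D_3, ..., D_(5d+1). *)
Definition Dfam (j : 'I_(5 * d - 1)) : {mpoly F[\dim {:Mspace}]} := Dpoly (j + 3).

Definition omega : dform Mspace (5 * d - 1) := wedge (fun j => differential (Dfam j)).

End Omega.

End RationalCurves.

(* Main.v *)
From HB Require Import structures.
Require Import Defs.
From mathcomp Require Import all_boot all_order all_algebra.
From mathcomp Require boolp.
Local Open Scope ring_scope.

(** Let [Y] be the projection of [GammaL] to the space of maps.  A point [c]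
    of [Y] satisfies [c^*(f) = 0] for some non-zero [f] in the span of [f0],
    [f1], [f2]; the coefficients of [f] give a linear relation between the
    columns of the determinant defining [D_i(c)], so all the [D_i] vanish on
    [Y] ([Dpoly_zero]).

    By hypothesis the ideal [I] agrees with the ideal of the [D_i] where some
    polynomial [h] is invertible.  At a zero of all the [D_i] with [h <> 0],
    the product rule then shows that [I] and the [D_i] have the same tangent
    vectors ([tangent_space_of_generators]): the tangent space is the common
    kernel of the [dD_i].  Where [omega], the wedge of these [5d - 1] linear
    forms, is non-zero, the forms are linearly independent and their common
    kernel has codimension [5d - 1] ([dim_common_kernel]).

    The two open conditions [h <> 0] and [omega <> 0] each hold somewhere on
    [Y].  As [GammaL] is irreducible, so is its image [Y]
    ([irreducible_projM]), and the two conditions hold together on a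
    non-empty open subset of [Y] ([irreducible_nonvanishing]).  The closed sets
    of exceptional triples of quintics and of exceptional tuples [t] are empty. *)

Set Implicit Arguments.
Unset Strict Implicit.
Unset Printing Implicit Defensive.

Import GRing.Theory.

(** * Polynomial functions and their differentials *)

Section Differential.
Variables (F : fieldType) (V : vectType F).
Implicit Types (p q h : {mpoly F[\dim {:V}]}) (x v : V).

Lemma evalp_linear_poly (l : {linear V -> F^o}) x :
  evalp (linear_poly l) x = l x.
Proof.
rewrite /evalp /linear_poly rmorph_sum /= [in RHS](coord_vbasis (memvf x)).
rewrite linear_sum /=; apply: eq_bigr => k _.
by rewrite mevalZ mevalXU linearZ /= mulrC.
Qed.

Lemma differentialD p q x v :
  differential (p + q) x v = differential p x v + differential q x v.
Proof.
rewrite /differential -big_split /=; apply: eq_bigr => k _.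
by rewrite mderivD mevalD mulrDl.
Qed.

Lemma differentialM p q x v :
  differential (p * q) x v
  = differential p x v * evalp q x + evalp p x * differential q x v.
Proof.
rewrite /differential mulr_suml mulr_sumr -big_split /=.
apply: eq_bigr => k _; rewrite mderivM mevalD !mevalM /evalp mulrDl mulrA.
by congr (_ + _); rewrite -!mulrA; congr (_ * _); rewrite mulrC.
Qed.

Lemma differential0 x v : differential 0 x v = 0.
Proof.
by rewrite /differential big1 // => k _; rewrite mderiv0 meval0 mul0r.
Qed.

Lemma differential_is_linear p x : linear (differential p x : V -> F^o).
Proof.
move=> a u v; rewrite /differential scaler_sumr -big_split /=.
apply: eq_bigr => k _; rewrite /coords linearP /=.
by rewrite mulrDr /GRing.scale /= mulrCA.
Qed.

Lemma evalp_generated n (D : 'I_n -> {mpoly F[\dim {:V}]}) p x :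
  (forall j, evalp (D j) x = 0) -> generated_by D p -> evalp p x = 0.
Proof.
move=> D0 [a ->]; rewrite /evalp rmorph_sum /= big1 // => j _.
by rewrite mevalM [X in _ * X]D0 mulr0.
Qed.

Lemma differential_generated n (D : 'I_n -> {mpoly F[\dim {:V}]}) p x v :
    (forall j, evalp (D j) x = 0) -> (forall j, differential (D j) x v = 0) ->
  generated_by D p -> differential p x v = 0.
Proof.
move=> D0 dD0 [a ->].
elim/big_rec: _ => [|j q _ IH]; first exact: differential0.
by rewrite differentialD differentialM D0 dD0 IH !mulr0 !addr0.
Qed.

(** Multiplying by a power of a polynomial that does not vanish at [x] changes
    neither the vanishing at [x] nor, at a zero, the kernel of the differential. *)
Lemma evalp_unit_mul h k p x :
  evalp h x != 0 -> evalp (h ^+ k * p) x = 0 -> evalp p x = 0.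
Proof.
move=> hx /eqP; rewrite /evalp mevalM rmorphXn mulf_eq0 expf_eq0.
by rewrite /= -/(evalp h x) (negPf hx) andbF => /eqP.
Qed.

Lemma differential_unit_mul h k p x v :
    evalp h x != 0 -> evalp p x = 0 -> differential (h ^+ k * p) x v = 0 ->
  differential p x v = 0.
Proof.
move=> hx p0; rewrite differentialM p0 mulr0 add0r /evalp rmorphXn /=.
move/eqP; rewrite mulf_eq0 expf_eq0.
by rewrite /= -/(evalp h x) (negPf hx) andbF => /eqP.
Qed.

(** Where [h] is invertible the ideals of [I] and [D] agree, and at a common
    zero of the [D j] the differential of an element of an ideal is determined
    by those of its generators. *)
Lemma tangent_space_of_generators n (I : {mpoly F[\dim {:V}]} -> Prop)
    (D : 'I_n -> {mpoly F[\dim {:V}]}) h x v :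
    (forall p, (exists k, I (h ^+ k * p)) <->
               (exists k, generated_by D (h ^+ k * p))) ->
    evalp h x != 0 -> (forall j, evalp (D j) x = 0) ->
  in_tangent_space I x v <-> forall j, differential (D j) x v = 0.
Proof.
move=> eqID hx D0; split=> [tgt j | dD0 p Ip].
- have [|k IhD] := (eqID (D j)).2.
    exists 0%N, (fun i => (i == j)%:R); rewrite expr0 mul1r (bigD1 j) //= eqxx.
    by rewrite mul1r big1 ?addr0 // => i /negPf->; rewrite mul0r.
  by apply: (differential_unit_mul hx (D0 j)); apply: tgt IhD.
- have [|k gen] := (eqID p).1; first by exists 0%N; rewrite expr0 mul1r.
  have p0 := evalp_unit_mul hx (evalp_generated D0 gen).
  exact: (differential_unit_mul hx p0 (differential_generated D0 dD0 gen)).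
Qed.

(** If the wedge of [n] linear forms is non-zero on [w], then the values of the
    forms on [w] are the columns of an invertible matrix, so that the forms map
    [V] onto [F^n]. *)
Lemma dim_common_kernel n (phi : 'I_n -> V -> V -> F) x w :
    (forall j, linear (phi j x : V -> F^o)) -> wedge phi x w != 0 ->
  exists2 T : {vspace V}, forall v, v \in T <-> forall j, phi j x v = 0
    & \dim T = (\dim {:V} - n)%N.
Proof.
move=> phi_lin det_n0.
pose f v : 'rV[F]_n := \row_j phi j x v.
have f_lin : linear f.
  by move=> a u v; apply/rowP=> j; rewrite !mxE; apply: phi_lin.
pose fL := GRing.isLinear.Build _ _ _ _ f f_lin.
pose g : {linear V -> 'rV[F]_n} := HB.pack f fL.
have gE v : linfun g v = f v by rewrite lfunE.
exists (lker (linfun g)) => [v|].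
  rewrite memv_ker gE; split=> [/eqP/rowP f0 j|phi0].
    by have := f0 j; rewrite !mxE.
  by apply/eqP/rowP=> j; rewrite !mxE.
have im_full : limg (linfun g) = fullv.
  apply/vspaceP=> y; rewrite memvf.
  pose A := \matrix_(a < n, b < n) phi a x (w b).
  have A_unit : A^T \in unitmx by rewrite unitmx_tr unitmxE unitfE.
  rewrite -(mulmxKV A_unit y) mulmx_sum_row memv_suml // => b _; apply: memvZ.
  rewrite (_ : row b A^T = linfun g (w b)) ?memv_img ?memvf //.
  by rewrite gE; apply/rowP=> j; rewrite !mxE.
have := limg_ker_dim (linfun g) fullv.
by rewrite capfv im_full !dimvf /dim /= mul1n => <-; rewrite addnK.
Qed.

(** The coefficients of the wedge of differentials are polynomial functions. *)
Definition wedge_poly n (D : 'I_n -> {mpoly F[\dim {:V}]}) (w : 'I_n -> V) :=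
  \det (\matrix_(a < n, b < n)
    \sum_k (D a)^`M(k) * (coords (w b) k)%:MP) : {mpoly F[\dim {:V}]}.

Lemma evalp_wedge_poly n (D : 'I_n -> {mpoly F[\dim {:V}]}) w x :
  evalp (wedge_poly D w) x = wedge (fun j => differential (D j)) x w.
Proof.
rewrite /evalp /wedge_poly -det_map_mx; congr (\det _).
apply/matrixP=> a b; rewrite !mxE rmorph_sum /=.
by apply: eq_bigr => k _; rewrite mevalM mevalC.
Qed.

End Differential.

(** * Zariski topology *)

Section Topology.
Variable F : fieldType.

Lemma zclosed_zeros (V : vectType F) (p : {mpoly F[\dim {:V}]}) :
  zclosed (fun x => evalp p x = 0).
Proof.
exists (fun q => q = p) => x; split=> [px0 q v -> -> //|]; exact.
Qed.

Lemma zclosed_empty (V : vectType F) : zclosed (fun _ : V => False).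
Proof.
exists (fun=> True) => x; split=> // /(_ 1 x Logic.I erefl) /eqP.
by rewrite /evalp meval1 oner_eq0.
Qed.

Lemma generic_forall (V : vectType F) (P : V -> Prop) :
  (forall x, P x) -> generic P.
Proof.
move=> allP; exists (fun=> False); first exact: zclosed_empty.
by split=> [|x _ _]; [exists 0 | apply: allP].
Qed.

(** A polynomial on [V] is also a polynomial on [V * W], by substituting the
    coordinates of the first component. *)
Lemma zclosed_preim_fst (V W : vectType F) (A : V -> Prop) :
  zclosed A -> zclosed_prod (fun x : V * proj W => A x.1).
Proof.
move=> [I AE].
pose l (k : 'I_(\dim {:V})) (y : V * W) : F := coords y.1 k.
have l_lin k : linear (l k : _ -> F^o).
  by move=> a u v; rewrite /l /coords linearP.
pose g k : {linear (V * W)%type -> F^o} :=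
  HB.pack (l k) (GRing.isLinear.Build F (V * W)%type F^o _ (l k) (l_lin k)).
pose pull (p : {mpoly F[\dim {:V}]}) :=
  p \mPo [tuple linear_poly (g k) | k < \dim {:V}].
have pullE p y : evalp (pull p) y = evalp p y.1.
  rewrite /evalp /pull comp_mpoly_meval; apply: meval_eq => k.
  by rewrite tnth_map tnth_ord_tuple; apply: (evalp_linear_poly (g k)).
exists (fun q => exists2 p, I p & q = pull p) => x.
split=> [Ax q y [p Ip ->] [yx _]|H].
  by rewrite pullE; apply: (AE x.1).1 Ip yx.
(* Whatever the line [x.2] is, the cone of [x] contains [(x.1, 0)]. *)
apply/AE => p v Ip ->; rewrite -(pullE p (x.1, 0)).
by apply: H; [exists p | split; rewrite //= mem0v].
Qed.

(** An irreducible set is not covered by the zeros of [p] and those of [q]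
    unless one of the two contains it. *)
Lemma irreducible_nonvanishing (V : vectType F) (Y : V -> Prop)
    (p q : {mpoly F[\dim {:V}]}) :
    irreducible (@zclosed F V) Y ->
    (exists2 x, Y x & evalp p x <> 0) -> (exists2 x, Y x & evalp q x <> 0) ->
  exists2 A, zclosed A & (exists2 x, Y x & ~ A x) /\
    forall x, ~ A x -> evalp p x != 0 /\ evalp q x != 0.
Proof.
move=> [_ irr] [x Yx px] [y Yy qy].
have pq0 z : evalp (p * q) z = 0 <-> evalp p z = 0 \/ evalp q z = 0.
  rewrite /evalp mevalM; split=> [/eqP|[]->]; rewrite ?mul0r ?mulr0 //.
  by rewrite mulf_eq0 => /orP[]/eqP; [left|right].
exists (fun z => evalp (p * q) z = 0); first exact: zclosed_zeros.
split=> [|z nz]; last first.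
  by split; apply/eqP => z0; apply: nz; apply/pq0; [left | right].
apply: boolp.contrapT => pq_zero.
have [z Yz|px0|qy0] := irr _ _ (zclosed_zeros p) (zclosed_zeros q).
- by apply: (pq0 z).1; apply: boolp.contrapT => nz; apply: pq_zero; exists z.
- exact: px (px0 x Yx).
- exact: qy (qy0 y Yy).
Qed.

End Topology.

(** * The incidence scheme over a plane of quintics *)

Section Curves.
Variables (F : fieldType) (d : nat).
Implicit Types (c : Mspace F d) (f : quintic F).

(** The projection is continuous, so it preserves irreducibility. *)
Lemma irreducible_projM (GL : Mspace F d * proj (quintic F) -> Prop) :
  irreducible (@zclosed_prod _ _ _) GL -> irreducible (@zclosed _ _) (projM GL).
Proof.
move=> [[[c s] GLcs] irr]; split=> [|A B clA clB YAB]; first by exists c, s.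
have [|A1|B1] :=
  irr _ _ (zclosed_preim_fst _ clA) (zclosed_preim_fst _ clB).
- by move=> [c' s'] GL'; apply: YAB; exists s'.
- by left=> c' [s' /A1].
- by right=> c' [s' /B1].
Qed.

Lemma evalp_value_poly f (z : F) c :
  evalp (value_poly d f z) c = (pullback c f).[z].
Proof.
rewrite /evalp /value_poly comp_mpoly_meval.
pose l k (c' : Mspace F d) : F^o := (section c' k).[z].
have l_lin k : linear (l k).
  by move=> a u v; rewrite /l /section !linearP /= hornerD hornerZ.
pose g k : {linear Mspace F d -> F^o} :=
  HB.pack (l k) (GRing.isLinear.Build F (Mspace F d) F^o _ (l k) (l_lin k)).
rewrite (@meval_eq _ _ _ (fun k => (section c k).[z])) => [|k]; last first.
  by rewrite tnth_map tnth_ord_tuple; apply: (evalp_linear_poly (g k)).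
rewrite /pullback /mmap /meval /mmap horner_sum; apply: eq_bigr => m _.
rewrite hornerM hornerC; congr (_ * _).
by rewrite /mmap1 horner_prod; apply: eq_bigr => k _; rewrite horner_exp.
Qed.

(** A non-zero quintic on the line [s] is a combination of [f2], [f1], [f0]; as
    [c] pulls it back to 0, its coefficients give a relation between the columns
    of the determinant. *)
Lemma Dpoly_zero (f0 f1 f2 : quintic F) (t : 'rV[F]_(5 * d).+1) (i : nat)
    c (s : proj (quintic F)) :
    plane f0 f1 f2 s -> (forall f, f \in val s -> pullback c f = 0) ->
  evalp (Dpoly f0 f1 f2 t i) c = 0.
Proof.
move=> s_plane vanish.
have f_s := memv_pick (val s); set f := vpick _ in f_s.
have f_n0 : f != 0 by rewrite vpick0 -dimv_eq0 (eqP (valP s)).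
have /(subvP s_plane) := f_s.
rewrite span_cons => /memv_addP[_ /vlineP[a0 ->] [g + fE]].
rewrite span_cons => /memv_addP[_ /vlineP[a1 ->] [g2 + gE]].
rewrite span_seq1 => /vlineP[a2 g2E]; rewrite {}gE {}g2E in fE.
pose u : 'rV[F]_3 := \row_(q < 3) nth 0 [:: a2; a1; a0] q.
rewrite /evalp /Dpoly -det_map_mx -det_tr; apply/eqP/det0P; exists u.
  apply: contraNneq f_n0 => /rowP u0; rewrite fE.
  have := (u0 0, u0 1, u0 2%:R); rewrite !mxE /= => -[[-> ->] ->].
  by rewrite !scale0r !addr0.
have f_rel z : a0 * (pullback c f0).[z] + (a1 * (pullback c f1).[z]
                 + a2 * (pullback c f2).[z]) = 0.
  have := congr1 (horner^~ z) (vanish f f_s).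
  by rewrite fE /pullback /= !mmapD !mmapZ horner0 !hornerD !hornerM !hornerC.
apply/rowP=> r; rewrite !mxE !big_ord_recl big_ord0 addr0 !mxE /=.
rewrite -!/(evalp _ c) !evalp_value_poly.
by rewrite addrC -addrA addrCA f_rel.
Qed.

End Curves.

(** * Tangent spaces at generic points *)

Theorem proposition1p4 (R : realType) (d : nat) (hd : (1 <= d)%N)
  (Gamma : Mspace R[i] d * proj (quintic R[i]) -> Prop)
  (Gamma_component : irreducible_component (@zclosed_prod _ _ _) (@incidence R[i] d) Gamma)
  (Gamma_dominates : dominates Gamma) :
  generic (fun f : (quintic R[i] * quintic R[i] * quintic R[i])%type =>
    let: (f0, f1, f2) := f in
    free [:: f0; f1; f2] ->
    forall L : proj (quintic R[i]) -> Prop,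
    open_in (@zclosed_proj _ _) (plane f0 f1 f2) L ->
    (forall s, val s = <[f0]>%VS -> L s) ->
    forall GammaL : Mspace R[i] d * proj (quintic R[i]) -> Prop,
    irreducible_component (@zclosed_prod _ _ _) (restrict_to Gamma L) GammaL ->
    onto GammaL L ->
    generic (fun t : 'rV[R[i]]_(5 * d).+1 =>
      injective (t 0) ->
      forall I : {mpoly R[i][\dim {:Mspace R[i] d}]} -> Prop,
      is_ideal I ->
      defined_at_generic_point (projM GammaL) I (Dfam f0 f1 f2 t) ->
      (exists2 c, projM GammaL c & nonzero_at (omega f0 f1 f2 t) c) ->
      generic_on (@zclosed _ _) (projM GammaL) (fun c =>
        tangent_space_dim I c
          (\dim {:Mspace R[i] d} - form_degree (omega f0 f1 f2 t))%N))).
Proof.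
apply: generic_forall => -[[f0 f1] f2] _ L [A _ LE] _ GL [GL_sub GL_irr _] _.
apply: generic_forall => t _ I _ [h h_n0 eqID] [c0 Yc0 [w w_n0]].
have D0 c j : projM GL c -> evalp (Dfam f0 f1 f2 t j) c = 0.
  move=> [s /GL_sub[Gcs /LE[s_plane _]]].
  have [Gamma_inc _ _] := Gamma_component.
  by have [_ vanish] := Gamma_inc _ Gcs; apply: Dpoly_zero s_plane vanish.
have [|B clB [B_n0 BP]] := irreducible_nonvanishing
    (q := wedge_poly (Dfam f0 f1 f2 t) w) (irreducible_projM GL_irr) h_n0.
  by exists c0; rewrite // evalp_wedge_poly.
exists B => //; split=> // c Yc /BP[hc]; rewrite evalp_wedge_poly => wc.
have [|T TE dimT] := dim_common_kernel _ wc.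
  by move=> j; apply: differential_is_linear.
exists T => // v; apply: (iff_trans (TE v)); apply: iff_sym.
by apply: tangent_space_of_generators eqID hc _ => j; apply: D0.
Qed.
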